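(* Let $\Bbbk$ be an algebraically closed field, let $d\geq 3$, let $P_1,\ldots,P_{d+4}$ be points in $\mathbb{P}^d=\mathbb{P}^d_{\Bbbk}$, and let $I=\{i_1<\ldots<i_6\}\subseteq\{1,\ldots,d+4\}$ be a $6$-element subset with complement $I^c=\{j_1<\ldots<j_{d-2}\}$. Let $\{j_1,\ldots,j_{d-2}\}=J_1\amalg J_2\amalg J_3\amalg J_4$ be a partition, where in each $J_i$ the indices are in ascending order (each $J_i$ could possibly be empty). Then the Grassmann--Cayley algebra equation \begin{gather*} (P_{i_1}P_{i_2}\wedge P_{i_4}P_{i_5}P_{j_1}\ldots P_{j_{d-2}})\vee(P_{i_2}P_{i_3}\wedge P_{i_5}P_{i_6}P_{j_1}\ldots P_{j_{d-2}})\\ \vee(P_{i_3}P_{i_4}\wedge P_{i_6}P_{i_1}P_{j_1}\ldots P_{j_{d-2}})\vee P_{j_1}\ldots P_{j_{d-2}}=0 \end{gather*} can be rewritten as (that is, it is equivalent to) the equation \begin{gather*} \Big(P_{i_1}P_{i_2}\big(\textstyle\bigvee_{j\in J_1}P_j\big)\wedge P_{i_4}P_{i_5}P_{j_1}\ldots P_{j_{d-2}}\Big)\vee\Big(P_{i_2}P_{i_3}\big(\textstyle\bigvee_{j\in J_2}P_j\big)\wedge P_{i_5}P_{i_6}P_{j_1}\ldots P_{j_{d-2}}\Big)\\ \vee\Big(P_{i_3}P_{i_4}\big(\textstyle\bigvee_{j\in J_3}P_j\big)\wedge P_{i_6}P_{i_1}P_{j_1}\ldots P_{j_{d-2}}\Big)\vee\big(\textstyle\bigvee_{j\in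 J_4}P_j\big)=0. \end{gather*}
   Context: Grassmann--Cayley algebra: let $V=\Bbbk^{d+1}$, and set $D=d+1$. The Grassmann--Cayley algebra of $V$ is the exterior algebra $\Lambda(V)$ with two operations. The join $\vee$ is the usual exterior product, also written by juxtaposition: $v_1\vee\cdots\vee v_k=v_1\ldots v_k$ (an extensor of step $k$); an empty join is omitted (equals $1$). For $v_1,\dots,v_D\in V$, $[v_1\ldots v_D]\in\Bbbk$ is the determinant of the matrix of coordinates of $v_1,\dots,v_D$; it is identified with $v_1\ldots v_D$. For $j+k\ge D$, the meet $\wedge$ of two extensors is $$(a_1\ldots a_j)\wedge(b_1\ldots b_k)=\sum_\sigma\operatorname{sign}(\sigma)[a_{\sigma(1)}\ldots a_{\sigma(D-k)}b_1\ldots b_k]\,a_{\sigma(D-k+1)}\ldots a_{\sigma(j)}\in\Lambda^{j+k-D}(V),$$ the sum being over permutations $\sigma$ of $\{1,\ldots,j\}$ with $\sigma(1)<\ldots<\sigma(D-k)$ and $\sigma(D-k+1)<\ldots<\sigma(j)$. Both operations are extended by distributivity. In a Grassmann--Cayley expression involving points of $\mathbb{P}^d$, each point is replaced by a nonzero vector of $V$ representing it; the vanishing of the expression does not depend on the choice of representatives. In expressions such as $P_{i_1}P_{i_2}(\bigvee_{j\in J_1}P_j)\wedge P_{i_4}P_{i_5}P_{j_1}\ldots P_{j_{d-2}}$, the juxtapositions (joins) on each side of $\wedge$ are performed before the meet. *)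

(* Defs.v *)
From HB Require Import structures.
From mathcomp Require Import all_boot all_order all_algebra all_fingroup.

Set Implicit Arguments.
Unset Strict Implicit.
Unset Printing Implicit Defensive.

Import GRing.Theory.
Local Open Scope ring_scope.

Section GrassmannCayley.
Variables (K : fieldType) (D : nat).
Local Notation V := 'rV[K]_D.

(* The exterior algebra of V = K^D in coordinates: [x S] is the coefficient of *)
(* e_S = e_(s_1) ... e_(s_k), where S = {s_1 < ... < s_k}.                    *)
Local Notation extalg := {ffun {set 'I_D} -> K^o}.

Definition ebasis (S : {set 'I_D}) : extalg := [ffun T => (T == S)%:R].

Definition bilinear_ext (f : {set 'I_D} -> {set 'I_D} -> extalg)
    (x y : extalg) : extalg :=
  \sum_S \sum_T (x S * y T) *: f S T.

Definition inversions (S T : {set 'I_D}) : nat :=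
  #|[set p : 'I_D * 'I_D | [&& p.1 \in S, p.2 \in T & (p.2 < p.1)%N]]|.

Definition join_basis (S T : {set 'I_D}) : extalg :=
  if [disjoint S & T] then (-1) ^+ inversions S T *: ebasis (S :|: T) else 0.

Definition join : extalg -> extalg -> extalg := bilinear_ext join_basis.

Definition ext_one : extalg := ebasis set0.

Definition ext_vec (v : V) : extalg := \sum_i v 0 i *: ebasis [set i].

(* v_1 ... v_k *)
Definition extensor (s : seq V) : extalg :=
  \big[join/ext_one]_(v <- s) ext_vec v.

(* [v_1 ... v_D]; only meaningful on sequences of length D *)
Definition bracket (s : seq V) : K := \det (\matrix_(i < D) s`_i).

(* sigma is increasing on {i | i < p} and on {i | p <= i}                     *)
Definition shuffle (p n : nat) (sigma : 'S_n) : bool :=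
  [forall i : 'I_n, forall k : 'I_n,
    (i < k)%N && ((k < p)%N || (p <= i)%N) ==> (sigma i < sigma k)%N].

(* (a_(sigma 1), ..., a_(sigma j)) for a = (a_1, ..., a_j)                    *)
Definition permute (a : seq V) (sigma : 'S_(size a)) : seq V :=
  [seq a`_(sigma i) | i <- enum 'I_(size a)].

Definition meet_extensors (a b : seq V) : extalg :=
  let p := (D - size b)%N in
  \sum_(sigma : 'S_(size a) | shuffle p sigma)
    ((-1) ^+ sigma * bracket (take p (permute sigma) ++ b))
      *: extensor (drop p (permute sigma)).

Definition evecs (S : {set 'I_D}) : seq V := [seq delta_mx 0 i | i <- enum S].

(* The meet of elements of step j and k is only used for D <= j + k; outside  *)
(* this range it is set to 0.                                                 *)
Definition meet_basis (S T : {set 'I_D}) : extalg :=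
  if (D <= #|S| + #|T|)%N then meet_extensors (evecs S) (evecs T) else 0.

Definition meet : extalg -> extalg -> extalg := bilinear_ext meet_basis.

(* A point of the projective space of lines of K^D.                           *)
Record proj_point := ProjPoint { line_of : {vspace V}; _ : \dim line_of == 1%N }.

Definition represents (v : V) (P : proj_point) : Prop :=
  v != 0 /\ v \in line_of P.

(* [enum A] lists A in increasing order, cf. [sorted_enum_set] below.         *)
Definition points (n : nat) (v : 'I_n -> V) (A : {set 'I_n}) : seq V :=
  [seq v j | j <- enum A].

Lemma sorted_enum_set (n : nat) (A : {set 'I_n}) :
  sorted (fun i k : 'I_n => (i < k)%N) (enum A).
Proof.
rewrite {1}/enum_mem; apply: sorted_filter => [i k l|]; first exact: ltn_trans.
by rewrite -enumT -(sorted_map (f := val) (e' := ltn)) val_enum_ord iota_ltn_sorted.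
Qed.

Lemma ebasis_sum (x : extalg) : x = \sum_S x S *: ebasis S.
Proof.
apply/ffunP=> U; rewrite sum_ffunE (bigD1 U) //= !ffunE eqxx.
rewrite big1 ?addr0 => [|S neSU]; first by rewrite [_ *: _]mulr1.
by rewrite !ffunE eq_sym (negPf neSU) scaler0.
Qed.

Lemma ext_ind (P : extalg -> Prop) :
  P 0 -> (forall c x y, P x -> P y -> P (c *: x + y)) ->
  (forall S, P (ebasis S)) -> forall x, P x.
Proof.
move=> P0 PD Pe x; rewrite [x]ebasis_sum.
by elim/big_rec: _ => // S y _ Py; apply: PD.
Qed.

Section BilinearExt.
Variable f : {set 'I_D} -> {set 'I_D} -> extalg.
Local Notation B := (bilinear_ext f).

Lemma bilinear_extl c x y z : B (c *: x + y) z = c *: B x z + B y z.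
Proof.
rewrite scaler_sumr -big_split; apply: eq_bigr => S _ /=.
rewrite scaler_sumr -big_split; apply: eq_bigr => T _ /=.
by rewrite !ffunE scalerA -scalerDl mulrDl mulrA.
Qed.

Lemma bilinear_extr c x y z : B z (c *: x + y) = c *: B z x + B z y.
Proof.
rewrite scaler_sumr -big_split; apply: eq_bigr => S _ /=.
rewrite scaler_sumr -big_split; apply: eq_bigr => T _ /=.
by rewrite !ffunE scalerA -scalerDl mulrDr !mulrA [c * _]mulrC.
Qed.

Lemma bilinear_ext0l z : B 0 z = 0.
Proof. by have := bilinear_extl (-1) 0 0 z; rewrite !scaleN1r oppr0 addr0 addNr. Qed.

Lemma bilinear_ext0r z : B z 0 = 0.
Proof. by have := bilinear_extr (-1) 0 0 z; rewrite !scaleN1r oppr0 addr0 addNr. Qed.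

Lemma bilinear_extZl c x z : B (c *: x) z = c *: B x z.
Proof. by rewrite -[c *: x]addr0 bilinear_extl bilinear_ext0l addr0. Qed.

Lemma bilinear_extZr c x z : B z (c *: x) = c *: B z x.
Proof. by rewrite -[c *: x]addr0 bilinear_extr bilinear_ext0r addr0. Qed.

Lemma bilinear_extDl x y z : B (x + y) z = B x z + B y z.
Proof. by rewrite -[x in LHS]scale1r bilinear_extl scale1r. Qed.

Lemma bilinear_extDr x y z : B z (x + y) = B z x + B z y.
Proof. by rewrite -[x in LHS]scale1r bilinear_extr scale1r. Qed.

Lemma bilinear_ext_suml (I : finType) (P : pred I) F z :
  B (\sum_(i | P i) F i) z = \sum_(i | P i) B (F i) z.
Proof.
exact: (big_morph (B^~ z) (fun x y => bilinear_extDl x y z) (bilinear_ext0l z)).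
Qed.

Lemma bilinear_ext_sumr (I : finType) (P : pred I) F z :
  B z (\sum_(i | P i) F i) = \sum_(i | P i) B z (F i).
Proof.
exact: (big_morph (B z) (fun x y => bilinear_extDr x y z) (bilinear_ext0r z)).
Qed.

Lemma bilinear_ext_basis S T : B (ebasis S) (ebasis T) = f S T.
Proof.
rewrite /bilinear_ext (bigD1 S) //= (bigD1 T) //= !ffunE !eqxx mulr1 scale1r.
rewrite big1 ?addr0 => [|U /negPf neU]; last by rewrite !ffunE neU mulr0 scale0r.
rewrite big1 ?addr0 // => U /negPf neU.
by rewrite big1 // => W _; rewrite !ffunE neU mul0r scale0r.
Qed.

End BilinearExt.

Lemma inversionsUl (S T U : {set 'I_D}) :
  [disjoint S & T] ->
  inversions (S :|: T) U = (inversions S U + inversions T U)%N.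
Proof.
move=> dST; rewrite /inversions -cardsUI.
rewrite (_ : _ :&: _ = set0) ?cards0 ?addn0; last first.
  apply/setP=> -[i k]; rewrite !inE /=; apply/negP=> /andP[/and3P[iS _ _] /and3P[iT _ _]].
  by rewrite (disjointFr dST iS) in iT.
by apply: eq_card => -[i k]; rewrite !inE /= andb_orl.
Qed.

Lemma inversionsUr (S T U : {set 'I_D}) :
  [disjoint S & T] ->
  inversions U (S :|: T) = (inversions U S + inversions U T)%N.
Proof.
move=> dST; rewrite /inversions -cardsUI.
rewrite (_ : _ :&: _ = set0) ?cards0 ?addn0; last first.
  apply/setP=> -[i k]; rewrite !inE /=; apply/negP=> /andP[/and3P[_ iS _] /and3P[_ iT _]].
  by rewrite (disjointFr dST iS) in iT.
by apply: eq_card => -[i k]; rewrite !inE /= andb_orl andb_orr.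
Qed.

Lemma inversions0l (S : {set 'I_D}) : inversions set0 S = 0%N.
Proof. by apply: eq_card0 => p; rewrite !inE. Qed.

Lemma inversions0r (S : {set 'I_D}) : inversions S set0 = 0%N.
Proof. by apply: eq_card0 => p; rewrite !inE andbF. Qed.

Lemma setU_disjoint (S T U : {set 'I_D}) :
  [disjoint S :|: T & U] = [disjoint S & U] && [disjoint T & U].
Proof. by rewrite -!setI_eq0 setIUl setU_eq0. Qed.

Lemma join_linl c x y z : join (c *: x + y) z = c *: join x z + join y z.
Proof. exact: bilinear_extl. Qed.

Lemma join_linr c x y z : join z (c *: x + y) = c *: join z x + join z y.
Proof. exact: bilinear_extr. Qed.

Lemma join0x z : join 0 z = 0.
Proof. exact: bilinear_ext0l. Qed.

Lemma joinx0 z : join z 0 = 0.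
Proof. exact: bilinear_ext0r. Qed.

Lemma joinZl c x z : join (c *: x) z = c *: join x z.
Proof. exact: bilinear_extZl. Qed.

Lemma joinZr c x z : join z (c *: x) = c *: join z x.
Proof. exact: bilinear_extZr. Qed.

Lemma join_suml (I : finType) (P : pred I) F z :
  join (\sum_(i | P i) F i) z = \sum_(i | P i) join (F i) z.
Proof. exact: bilinear_ext_suml. Qed.

Lemma join_sumr (I : finType) (P : pred I) F z :
  join z (\sum_(i | P i) F i) = \sum_(i | P i) join z (F i).
Proof. exact: bilinear_ext_sumr. Qed.

Lemma join_ebasis S T : join (ebasis S) (ebasis T) = join_basis S T.
Proof. exact: bilinear_ext_basis. Qed.

Lemma join_ebasisA S T U :
  join (ebasis S) (join (ebasis T) (ebasis U))
  = join (join (ebasis S) (ebasis T)) (ebasis U).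
Proof.
rewrite !join_ebasis /join_basis.
transitivity (if [&& [disjoint S & T], [disjoint S & U] & [disjoint T & U]]
  then (-1) ^+ (inversions S T + inversions S U + inversions T U)
         *: ebasis (S :|: T :|: U) else 0 : extalg).
  case: (boolP [disjoint T & U]) => [dTU|_]; last first.
    by rewrite /join bilinear_ext0r !andbF.
  rewrite /join bilinear_extZr bilinear_ext_basis /join_basis andbT.
  rewrite disjoint_sym setU_disjoint ![[disjoint _ & S]]disjoint_sym.
  case: ifP => _; last by rewrite scaler0.
  by rewrite scalerA -exprD inversionsUr // setUA addnC.
case: (boolP [disjoint S & T]) => [dST|_]; last by rewrite /join bilinear_ext0l.
rewrite /join bilinear_extZl bilinear_ext_basis /join_basis.
rewrite setU_disjoint /=.
case: ifP => _; last by rewrite scaler0.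
by rewrite scalerA -exprD inversionsUl // addnA.
Qed.

Lemma joinA : associative join.
Proof.
move=> x y z; elim/ext_ind: x => [|c x x' IH IH'|S].
- by rewrite !join0x.
- by rewrite !join_linl IH IH'.
elim/ext_ind: y => [|c y y' IH IH'|T].
- by rewrite join0x !joinx0 join0x.
- by rewrite join_linl !join_linr join_linl IH IH'.
elim/ext_ind: z => [|c z z' IH IH'|U].
- by rewrite !joinx0.
- by rewrite !join_linr IH IH'.
exact: join_ebasisA.
Qed.

Lemma join1x : left_id ext_one join.
Proof.
elim/ext_ind=> [|c x x' IH IH'|S]; first by rewrite joinx0.
  by rewrite join_linr IH IH'.
by rewrite join_ebasis /join_basis -setI_eq0 set0I eqxx inversions0l scale1r set0U.
Qed.

Lemma joinx1 : right_id ext_one join.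
Proof.
elim/ext_ind=> [|c x x' IH IH'|S]; first by rewrite join0x.
  by rewrite join_linl IH IH'.
by rewrite join_ebasis /join_basis -setI_eq0 setI0 eqxx inversions0r scale1r setU0.
Qed.

HB.instance Definition _ := Monoid.isLaw.Build extalg ext_one join joinA join1x joinx1.

Lemma ext_vec_linear c u v : ext_vec (c *: u + v) = c *: ext_vec u + ext_vec v.
Proof.
rewrite /ext_vec scaler_sumr -big_split; apply: eq_bigr => i _.
by rewrite !mxE scalerDl scalerA.
Qed.

Lemma ext_vec_delta i : ext_vec (delta_mx 0 i) = ebasis [set i].
Proof.
rewrite /ext_vec (bigD1 i) //= mxE !eqxx scale1r big1 ?addr0 // => k ne.
by rewrite mxE eqxx /= (negPf ne) scale0r.
Qed.

Lemma inversions1 (i k : 'I_D) : inversions [set i] [set k] = (k < i)%N.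
Proof.
rewrite /inversions; case: ltnP => [lt|le] /=.
  rewrite (_ : [set _ | _] = [set (i, k)]) ?cards1 //.
  apply/setP=> -[a b]; rewrite !inE /= xpair_eqE.
  by case: eqP => //= ->; case: eqP => //= ->.
apply: eq_card0 => -[a b]; rewrite !inE /=.
by apply/and3P=> -[/eqP-> /eqP->]; rewrite ltnNge le.
Qed.

Lemma ext_vec_sqr v : join (ext_vec v) (ext_vec v) = 0.
Proof.
rewrite {1}/ext_vec join_suml.
pose G i k : extalg := (v 0 i * v 0 k) *: join_basis [set i] [set k].
rewrite (eq_bigr (fun i => \sum_k G i k)) => [|i _]; last first.
  rewrite joinZl join_sumr scaler_sumr; apply: eq_bigr => k _.
  by rewrite joinZr join_ebasis scalerA.
have GC (i k : 'I_D) : (i < k)%N -> G i k = - G k i.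
  move=> lt; rewrite /G /join_basis !disjoints1 !inE eq_sym.
  have /negPf-> : k != i by rewrite -val_eqE neq_ltn lt orbT.
  rewrite /= !inversions1 lt ltnNge (ltnW lt) /= mulrC setUC.
  by rewrite expr0 expr1 scale1r scaleN1r scalerN opprK.
have G0 i : G i i = 0 by rewrite /G /join_basis disjoints1 inE eqxx scaler0.
rewrite pair_big /= (bigID (fun p : 'I_D * 'I_D => p.1 < p.2)%N) /=.
rewrite [X in _ + X](bigID (fun p : 'I_D * 'I_D => p.2 < p.1)%N) /=.
rewrite [X in _ + (_ + X)]big1 ?addr0; last first.
  move=> [i k] /=; rewrite -!leqNgt -eqn_leq => /eqP/val_inj->; exact: G0.
rewrite (reindex_inj (h := fun p : 'I_D * 'I_D => (p.2, p.1))) /=; last first.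
  by move=> [a b] [c d] [-> ->].
rewrite [X in X + _](eq_bigr (fun p => - G p.1 p.2)) => [|p lt]; last exact: GC.
rewrite sumrN; apply/eqP; rewrite addrC subr_eq0; apply/eqP/eq_bigl => -[a b] /=.
by rewrite -leqNgt andb_idl // => /ltnW.
Qed.

Lemma extensor_nil : extensor [::] = ext_one.
Proof. exact: big_nil. Qed.

Lemma extensor_cons v s : extensor (v :: s) = join (ext_vec v) (extensor s).
Proof. exact: big_cons. Qed.

Lemma extensor_cat s t : extensor (s ++ t) = join (extensor s) (extensor t).
Proof. exact: big_cat. Qed.

Section Shuffles.
Variable W : lmodType K.
Implicit Type f : seq V -> seq V -> W.

Fixpoint shuffle_sum p f (a : seq V) : W :=
  if a is v :: a' then
    (if p is p'.+1 then shuffle_sum p' (fun x y => f (v :: x) y) a' else 0)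
      + (-1) ^+ p *: shuffle_sum p (fun x y => f x (v :: y)) a'
  else if p == 0 then f [::] [::] else 0.

Lemma shuffle_sum_gt p f a : (size a < p)%N -> shuffle_sum p f a = 0.
Proof.
elim: a p f => [|v a IH] [|p] f //= lt.
by rewrite !IH ?scaler0 ?addr0 // ltnW.
Qed.

Lemma sum_perm_lift n (P : pred 'S_n.+1) (F : 'S_n.+1 -> W) (i : 'I_n.+1) :
  \sum_(s | P s && (s i == ord0)) F s =
  \sum_(t : 'S_n | P (lift_perm i ord0 t)) F (lift_perm i ord0 t).
Proof.
rewrite (reindex (lift_perm i ord0)); last first.
  pose ulsf i (s : 'S_n.+1) k := odflt k (unlift (s i) (s (lift i k))).
  have ulsfK i' (s : 'S_n.+1) k : lift (s i') (ulsf i' s k) = s (lift i' k).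
    rewrite /ulsf; have := neq_lift i' k.
    by rewrite -(can_eq (permK s)) => /unlift_some[] ? ? ->.
  have inj_ulsf : injective (ulsf i _).
    move=> s; apply: can_inj (ulsf (s i) s^-1%g) _ => k'.
    by rewrite {1}/ulsf ulsfK !permK liftK.
  exists (fun s => perm (inj_ulsf s)) => [s _ | s].
    by apply/permP=> k'; rewrite permE /ulsf lift_perm_lift lift_perm_id liftK.
  case/andP=> _ /(s _ =P _) si0; apply/permP=> k.
  case: (unliftP i k) => [k'|] ->; rewrite ?lift_perm_id //.
  by rewrite lift_perm_lift -si0 permE ulsfK.
by apply: eq_bigl => t; rewrite lift_perm_id eqxx andbT.
Qed.

Lemma shuffle_lift_neq p n (i : 'I_n.+1) (t : 'S_n) :
  i != ord0 -> i != p :> nat -> shuffle p (lift_perm i ord0 t) = false.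
Proof.
rewrite -val_eqE /= => i0 ip; apply/negP=> /forallP sh.
case: (ltnP i p) => [ltip|lepi].
  have /forallP/(_ i)/implyP := sh ord0.
  by rewrite lift_perm_id ltip lt0n i0 => /(_ isT).
have ltpi : (p < i)%N by rewrite ltn_neqAle eq_sym ip.
have /forallP/(_ i)/implyP := sh (Ordinal (ltn_trans ltpi (ltn_ord i))).
by rewrite lift_perm_id /= ltpi leqnn orbT => /(_ isT).
Qed.

Lemma shuffle_lift0 p n (t : 'S_n) :
  shuffle p.+1 (lift_perm ord0 ord0 t) = shuffle p t.
Proof.
apply/forallP/forallP=> sh i; apply/forallP=> k; apply/implyP.
  move=> ltik; have /forallP/(_ (lift ord0 k))/implyP := sh (lift ord0 i).
  by rewrite !lift_perm_lift !lift0 => /(_ ltik).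
case: (unliftP ord0 i) => [i'|] ->; case: (unliftP ord0 k) => [k'|] ->;
  rewrite ?lift_perm_lift ?lift_perm_id ?lift0 //=.
by rewrite !ltnS => ltik; have /forallP/(_ k')/implyP := sh i'; apply.
Qed.

Lemma shuffle_liftp p n (ltpn : (p < n.+1)%N) (t : 'S_n) :
  shuffle p (lift_perm (Ordinal ltpn) ord0 t) = shuffle p t.
Proof.
have bump_lt m : (bump p m < p)%N = (m < p)%N.
  by rewrite /bump; case: (leqP p m) => //= le; apply/negbTE; rewrite -leqNgt (leq_trans le) ?leq_addl.
have bump_ge m : (p <= bump p m)%N = (p <= m)%N by rewrite leqNgt bump_lt -leqNgt.
have bump2 m q : (bump p m < bump p q)%N = (m < q)%N.
  by rewrite !ltnNge leq_bump2.
apply/forallP/forallP=> sh i; apply/forallP=> k; apply/implyP.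
  move=> ltik; have /forallP/(_ (lift (Ordinal ltpn) k))/implyP := sh (lift (Ordinal ltpn) i).
  by rewrite !lift_perm_lift /= bump_lt bump_ge bump2 => /(_ ltik).
case: (unliftP (Ordinal ltpn) i) => [i'|] ->; case: (unliftP (Ordinal ltpn) k) => [k'|] ->;
  rewrite ?lift_perm_lift ?lift_perm_id /= ?bump_lt ?bump_ge ?bump2 ?ltnn //=.
  by move=> ltik; have /forallP/(_ k')/implyP := sh i'; apply.
by case/andP=> lt; rewrite leqNgt lt.
Qed.

Lemma size_permute a (s : 'S_(size a)) : size (permute s) = size a.
Proof. by rewrite size_map size_enum_ord. Qed.

Lemma nth_permute a (s : 'S_(size a)) (i : 'I_(size a)) : (permute s)`_i = a`_(s i).
Proof.
by rewrite (nth_map i) ?size_enum_ord // nth_ord_enum.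
Qed.

Lemma permute_liftp v a p (ltpn : (p < (size a).+1)%N) (t : 'S_(size a)) :
  permute (lift_perm (Ordinal ltpn) ord0 t : 'S_(size (v :: a))) =
  take p (permute t) ++ v :: drop p (permute t).
Proof.
apply: (@eq_from_nth _ 0) => [|i].
  by rewrite size_cat /= addnS -size_cat cat_take_drop !size_permute.
rewrite size_permute => lti.
rewrite -[i]/(val (Ordinal lti)) nth_permute /=.
set j : 'I_(size a).+1 := Ordinal lti.
have sz : size (take p (permute t)) = p by rewrite size_takel // size_permute.
rewrite nth_cat sz -[i]/(val j).
case: (unliftP (Ordinal ltpn) j) => [j'|] ->.
  rewrite lift_perm_lift /= add0n -nth_permute /bump /=.
  case: (leqP p j') => [le|lt]; last by rewrite add0n lt nth_take.
  by rewrite add1n ltnNge ltnW ?ltnS //= subSn //= nth_drop subnKC.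
by rewrite lift_perm_id /= ltnn subnn.
Qed.

Lemma shuffle_sumE p f a : (p <= size a)%N ->
  \sum_(s : 'S_(size a) | shuffle p s)
     (-1) ^+ s *: f (take p (permute s)) (drop p (permute s)) = shuffle_sum p f a.
Proof.
elim: a p f => [|v a IH] p f.
  rewrite leqn0 => /eqP-> /=.
  have perm0 (s : 'S_0) : s = 1%g by apply/permP=> -[].
  rewrite (bigD1 1%g) /=; last by apply/forallP=> -[].
  rewrite big1 => [|s]; last by rewrite (perm0 s) eqxx andbF.
  rewrite odd_perm1 scale1r addr0 take0 drop0 /permute.
  by rewrite (size0nil (s := enum _)) ?size_enum_ord.
move=> lepn; rewrite [LHS](partition_big (fun s : 'S_(size a).+1 => s^-1%g ord0) xpredT) //=.
under eq_bigr => i _.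
  under eq_bigl => s.
    rewrite -(inj_eq (@perm_inj _ s)) permKV eq_sym.
    over.
  rewrite sum_perm_lift.
  over.
have main (ltpn : (p < (size a).+1)%N) :
  \sum_(t : 'S_(size a) | shuffle p (lift_perm (Ordinal ltpn) ord0 t))
     (let s := lift_perm (Ordinal ltpn) ord0 t : 'S_(size (v :: a)) in
      (-1) ^+ s *: f (take p (permute s)) (drop p (permute s)))
  = (-1) ^+ p *: shuffle_sum p (fun x y => f x (v :: y)) a.
  rewrite -IH // scaler_sumr; apply: eq_big => [t|t _]; first exact: shuffle_liftp.
  have sz : size (take p (permute t)) = p by rewrite size_takel // size_permute.
  rewrite /= permute_liftp take_size_cat // drop_size_cat //.
  by rewrite odd_lift_perm /= addbF signr_addb signr_odd scalerA.
case: p => [|p] in lepn main *.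
  rewrite add0r (bigD1 ord0) //= [X in _ + X]big1 ?addr0 => [|i ne].
    have -> : ord0 = Ordinal (ltn0Sn (size a)) by apply: val_inj.
    exact: main.
  by rewrite big_pred0 // => t; rewrite shuffle_lift_neq.
rewrite (bigD1 ord0) //=; congr (_ + _).
  rewrite -IH //; apply: eq_big => [t|t _]; first exact: shuffle_lift0.
  have e0 : Ordinal (ltn0Sn (size a)) = ord0 by apply: val_inj.
  have := permute_liftp v (ltn0Sn (size a)) t; rewrite e0 take0 drop0 /= => ->.
  by rewrite odd_lift_perm.
have [lt|ge] := ltnP p.+1 (size a).+1.
  rewrite -(main lt) (bigD1 (Ordinal lt)) //= [X in _ + X]big1 ?addr0 // => i /andP[i0 ip].
  by rewrite big_pred0 // => t; rewrite shuffle_lift_neq.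
rewrite shuffle_sum_gt // scaler0 big1 // => i i0.
rewrite big_pred0 // => t; rewrite shuffle_lift_neq //.
by apply: contraTneq (ltn_ord i) => ->; rewrite -leqNgt.
Qed.

End Shuffles.

Definition multilinear (W : lmodType K) (F : seq V -> W) :=
  forall s1 c u v s2,
    F (s1 ++ c *: u + v :: s2) = c *: F (s1 ++ u :: s2) + F (s1 ++ v :: s2).

Definition alternating (W : lmodType K) (F : seq V -> W) :=
  forall s1 u s2, F (s1 ++ u :: u :: s2) = 0.

Definition lin_ext (W : lmodType K) (g : {set 'I_D} -> W) (x : extalg) : W :=
  \sum_S (x S : K) *: g S.

Lemma lin_ext_linear (W : lmodType K) (g : {set 'I_D} -> W) c x y :
  lin_ext g (c *: x + y) = c *: lin_ext g x + lin_ext g y.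
Proof.
rewrite scaler_sumr -big_split; apply: eq_bigr => S _ /=.
by rewrite !ffunE scalerDl scalerA.
Qed.

Lemma lin_ext0 (W : lmodType K) (g : {set 'I_D} -> W) : lin_ext g 0 = 0.
Proof. by apply: big1 => S _; rewrite ffunE scale0r. Qed.

Lemma lin_ext_ebasis (W : lmodType K) (g : {set 'I_D} -> W) S :
  lin_ext g (ebasis S) = g S.
Proof.
rewrite /lin_ext (bigD1 S) //= ffunE eqxx scale1r big1 ?addr0 // => U /negPf neU.
by rewrite ffunE neU scale0r.
Qed.

Lemma lin_extZ (W : lmodType K) (g : {set 'I_D} -> W) c x :
  lin_ext g (c *: x) = c *: lin_ext g x.
Proof. by rewrite -[c *: x]addr0 lin_ext_linear lin_ext0 addr0. Qed.

Lemma lin_ext_sum (W : lmodType K) (g : {set 'I_D} -> W) (I : finType) F :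
  lin_ext g (\sum_(i : I) F i) = \sum_i lin_ext g (F i).
Proof.
apply: (big_morph (lin_ext g) _ (lin_ext0 g)) => x y.
by rewrite -[x in LHS]scale1r lin_ext_linear scale1r.
Qed.

Lemma enum_split (A : {set 'I_D}) (i : 'I_D) :
  enum A = [seq k <- take i (enum 'I_D) | k \in A] ++ nseq (i \in A) i
             ++ [seq k <- drop i.+1 (enum 'I_D) | k \in A].
Proof.
have lti : (i < size (enum 'I_D))%N by rewrite size_enum_ord.
have -> : enum A = [seq k <- enum 'I_D | k \in A].
  by rewrite enumT; apply: eq_filter => k.
rewrite -{1}(cat_take_drop i (enum 'I_D)) filter_cat (drop_nth i) // nth_ord_enum.
by rewrite /=; case: (i \in A).
Qed.

Lemma mem_take_enum (i k : 'I_D) : (k \in take i (enum 'I_D)) = (k < i)%N.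
Proof. by rewrite in_take ?mem_enum // index_enum_ord. Qed.

Lemma size_filter_take (i : 'I_D) (S : {set 'I_D}) :
  size [seq k <- take i (enum 'I_D) | k \in S] = inversions [set i] S.
Proof.
have u : uniq [seq k <- take i (enum 'I_D) | k \in S].
  by rewrite filter_uniq // take_uniq // enum_uniq.
rewrite -(card_uniqP u) -(card_imset _ (can_inj (fun k => erefl : (i, k).2 = k))).
apply: eq_card => -[a b]; rewrite !inE /=; apply/imsetP/idP.
  by case=> k; rewrite mem_filter mem_take_enum => /andP[kS lt] [-> ->]; rewrite eqxx kS.
by case/and3P=> /eqP-> bS lt; exists b => //; rewrite mem_filter mem_take_enum bS.
Qed.

Section AlternatingMultilinear.
Variables (W : lmodType K) (F : seq V -> W).
Hypotheses (linF : multilinear F) (altF : alternating F).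

Lemma multilinear_cons v : multilinear (fun s => F (v :: s)).
Proof. by move=> s1; apply: (linF (v :: s1)). Qed.

Lemma alternating_cons v : alternating (fun s => F (v :: s)).
Proof. by move=> s1; apply: (altF (v :: s1)). Qed.

Lemma multilinear0 s1 s2 : F (s1 ++ 0 :: s2) = 0.
Proof. by have := linF s1 (-1) 0 0 s2; rewrite !scaleN1r oppr0 addr0 addNr. Qed.

Lemma multilinear_sum s (I : finType) (c : I -> K) (w : I -> V) :
  F (\sum_i c i *: w i :: s) = \sum_i c i *: F (w i :: s).
Proof.
elim/big_rec2: _ => [|i x y _ IH]; first exact: (multilinear0 [::]).
by rewrite (linF [::]) /= IH.
Qed.

Lemma alternating_swap s1 u v s2 : F (s1 ++ u :: v :: s2) = - F (s1 ++ v :: u :: s2).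
Proof.
have lin2 x : F (s1 ++ x :: 1 *: u + v :: s2) = F (s1 ++ x :: u :: s2) + F (s1 ++ x :: v :: s2).
  by rewrite -cat_rcons linF !cat_rcons scale1r.
have := altF s1 (1 *: u + v) s2.
rewrite linF scale1r !lin2 !altF add0r addr0 => /eqP.
by rewrite addr_eq0 => /eqP.
Qed.

Lemma alternating_move s1 u t s2 :
  F (s1 ++ u :: t ++ s2) = (-1) ^+ size t *: F (s1 ++ t ++ u :: s2).
Proof.
elim: t s1 => [|v t IH] s1; first by rewrite scale1r.
by rewrite /= alternating_swap -cat_rcons IH cat_rcons exprS mulN1r scaleNr.
Qed.

Lemma alternating_evecs_cons i S :
  F (delta_mx 0 i :: evecs S) =
  if i \in S then 0 else (-1) ^+ inversions [set i] S *: F (evecs (i |: S)).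
Proof.
rewrite /evecs (enum_split S i) !map_cat.
rewrite (alternating_move [::]) size_map size_filter_take /=.
case: ifP => [iS|niS]; first by rewrite altF scaler0.
rewrite (enum_split (i |: S) i) !map_cat setU11 /=.
congr (_ *: F (_ ++ _ :: _)); congr map; apply: eq_in_filter => k.
  by rewrite mem_take_enum !inE -val_eqE ltn_neqAle => /andP[/negPf->].
move=> kd; rewrite !inE; case: eqP => //= eki.
have := enum_uniq 'I_D; rewrite -(cat_take_drop i.+1 (enum 'I_D)) cat_uniq.
case/and3P=> _ /hasPn/(_ k kd) + _; rewrite eki.
by rewrite in_take ?mem_enum // index_enum_ord ltnSn.
Qed.

Lemma lin_ext_join i x :
  lin_ext (F \o evecs) (join (ebasis [set i]) x) =
  lin_ext (fun S => F (delta_mx 0 i :: evecs S)) x.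
Proof.
elim/ext_ind: x => [|c x y IHx IHy|S].
- by rewrite joinx0 !lin_ext0.
- by rewrite join_linr !lin_ext_linear IHx IHy.
rewrite join_ebasis lin_ext_ebasis alternating_evecs_cons /join_basis disjoints1.
by case: (i \in S) => /=; rewrite ?lin_ext0 // lin_extZ lin_ext_ebasis.
Qed.

End AlternatingMultilinear.

(* The universal property of the exterior powers of K^D.                      *)
Lemma alternating_expand (W : lmodType K) (F : seq V -> W) (a : seq V) :
  multilinear F -> alternating F -> F a = lin_ext (F \o evecs) (extensor a).
Proof.
elim: a F => [|v a IH] F linF altF.
  by rewrite extensor_nil lin_ext_ebasis /= /evecs enum_set0.
rewrite extensor_cons /ext_vec join_suml lin_ext_sum {1}(row_sum_delta v).
rewrite multilinear_sum //; apply: eq_bigr => i _.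
rewrite joinZl lin_extZ lin_ext_join //; congr (_ *: _).
apply: (IH (fun s => F (delta_mx 0 i :: s))).
  exact: multilinear_cons.
exact: alternating_cons.
Qed.

Lemma extensor_multilinear : multilinear extensor.
Proof.
move=> s1 c u v s2; rewrite !extensor_cat !extensor_cons ext_vec_linear.
by rewrite join_linl join_linr.
Qed.

Lemma extensor_alternating : alternating extensor.
Proof.
move=> s1 u s2; rewrite extensor_cat !extensor_cons [join (ext_vec u) _]joinA ext_vec_sqr.
by rewrite join0x joinx0.
Qed.

Lemma size_evecs S : size (evecs S) = #|S|.
Proof. by rewrite size_map -cardE. Qed.

Lemma extensor_evecs S : extensor (evecs S) = ebasis S.
Proof.
have [n] := ubnP #|S|; elim: n S => // n IH S leSn.
have [->|[i iS]] := set_0Vmem S; first by rewrite /evecs enum_set0 extensor_nil.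
have := alternating_evecs_cons extensor_multilinear extensor_alternating i (S :\ i).
rewrite !inE eqxx /= setD1K // extensor_cons ext_vec_delta IH; last first.
  by move: leSn; rewrite (cardsD1 i S) iS add1n ltnS.
rewrite join_ebasis /join_basis disjoints1 !inE eqxx /= setD1K //.
by move/(congr1 ( *:%R ((-1) ^+ inversions [set i] (S :\ i)))); rewrite !scalerA -!expr2 !sqrr_sign !scale1r.
Qed.

Lemma multilinear_size (W : lmodType K) (F : seq V -> W) n :
  (forall s1 c u v s2, size (s1 ++ u :: s2) = n ->
    F (s1 ++ c *: u + v :: s2) = c *: F (s1 ++ u :: s2) + F (s1 ++ v :: s2)) ->
  multilinear (fun s => if size s == n then F s else 0).
Proof.
move=> linF s1 c u v s2.
have sz w : size (s1 ++ w :: s2) = size (s1 ++ u :: s2) by rewrite !size_cat.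
rewrite !(sz (_ + _), sz v); case: eqP => [/linF//|_].
by rewrite scaler0 addr0.
Qed.

Lemma alternating_size (W : lmodType K) (F : seq V -> W) n :
  (forall s1 u s2, size (s1 ++ u :: u :: s2) = n -> F (s1 ++ u :: u :: s2) = 0) ->
  alternating (fun s => if size s == n then F s else 0).
Proof. by move=> altF s1 u s2; case: eqP => // /altF. Qed.

Lemma extensor_homogeneous s (S : {set 'I_D}) : #|S| != size s -> extensor s S = 0.
Proof.
move=> neS; pose F t : extalg := if size t == size s then extensor t else 0.
have linF : multilinear F.
  by apply: multilinear_size => s1 c u v s2 _; apply: extensor_multilinear.
have altF : alternating F.
  by apply: alternating_size => s1 u s2 _; apply: extensor_alternating.
have := alternating_expand s linF altF; rewrite {1}/F eqxx => ->.
rewrite /lin_ext sum_ffunE big1 // => T _; rewrite ffunE /F /= size_evecs.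
case: eqP => [eT|_]; last by rewrite ffunE scaler0.
rewrite extensor_evecs ffunE; case: eqP => [eST|_]; last exact: scaler0.
by rewrite eST eT eqxx in neS.
Qed.

Lemma bracket_multilinear s1 c u v s2 : size (s1 ++ u :: s2) = D ->
  bracket (s1 ++ c *: u + v :: s2) =
  c * bracket (s1 ++ u :: s2) + bracket (s1 ++ v :: s2).
Proof.
rewrite size_cat /= addnS => sz; have lt : (size s1 < D)%N.
  have : (size s1 < (size s1 + size s2).+1)%N by rewrite ltnS leq_addr.
  by rewrite sz.
rewrite -[bracket (_ ++ v :: _)]mul1r.
apply: (determinant_multilinear (i0 := Ordinal lt)).
- by rewrite scale1r; apply/rowP=> k; rewrite !mxE /= !nth_cat ltnn subnn /= !mxE.
- apply/matrixP=> i k; rewrite !mxE !nth_cat /=.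
  have := neq_lift (Ordinal lt) i; rewrite -val_eqE /=.
  case: ltngtP => // lt' _.
  by move: lt'; rewrite -subn_gt0; case: (_ - _)%N.
- apply/matrixP=> i k; rewrite !mxE !nth_cat /=.
  have := neq_lift (Ordinal lt) i; rewrite -val_eqE /=.
  case: ltngtP => // lt' _.
  by move: lt'; rewrite -subn_gt0; case: (_ - _)%N.
Qed.

Lemma bracket_alternating s1 u s2 : size (s1 ++ u :: u :: s2) = D ->
  bracket (s1 ++ u :: u :: s2) = 0.
Proof.
rewrite size_cat /= !addnS => sz.
have lt1 : ((size s1).+1 < D)%N.
  have : ((size s1).+1 < (size s1 + size s2).+2)%N by rewrite !ltnS leq_addr.
  by rewrite sz.
apply: (determinant_alternate (i1 := Ordinal (ltnW lt1)) (i2 := Ordinal lt1)).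
  by rewrite -val_eqE /= neq_ltn leqnn.
by move=> k; rewrite !mxE !nth_cat /= ltnn subnn ltnNge leqnSn subSnn.
Qed.

Definition bracket0 (s : seq V) : K^o := if size s == D then bracket s else 0.

Lemma bracket0_multilinear : multilinear bracket0.
Proof. by apply: (@multilinear_size K^o); apply: bracket_multilinear. Qed.

Lemma bracket0_alternating : alternating bracket0.
Proof. by apply: (@alternating_size K^o); apply: bracket_alternating. Qed.

(* The identification of v_1 ... v_D with [v_1 ... v_D].                      *)
Lemma bracketE s : size s = D -> bracket s = extensor s [set: 'I_D].
Proof.
move=> sz; have := alternating_expand s bracket0_multilinear bracket0_alternating.
rewrite {1}/bracket0 sz eqxx => ->; rewrite /lin_ext (bigD1 setT) //= big1 ?addr0.
  rewrite /bracket0 size_evecs cardsT card_ord eqxx /bracket.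
  rewrite [X in \det X](_ : _ = 1%:M) ?det1; first exact: mulr1.
  apply/row_matrixP=> i; rewrite rowK row1 (nth_map i) -?cardE ?cardsT ?card_ord //.
  congr (delta_mx _ _); rewrite -[RHS](nth_ord_enum i); congr nth.
  by rewrite enum_setT enumT.
move=> S neS; rewrite extensor_homogeneous ?scale0r // sz.
apply: contraNneq neS => eS.
by rewrite eqEcard subsetT cardsT card_ord eS leqnn.
Qed.

Section ShuffleAlternating.
Variable W : lmodType K.
Implicit Type f : seq V -> seq V -> W.

Lemma eq_shuffle_sum p f g a : (forall x y, f x y = g x y) ->
  shuffle_sum p f a = shuffle_sum p g a.
Proof.
elim: a p f g => [|v a IH] p f g efg /=; first by rewrite efg.
congr (_ + _ *: _); last by apply: IH.
by case: p => // p; apply: IH.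
Qed.

Lemma shuffle_sum_linear p f g c a :
  shuffle_sum p (fun x y => c *: f x y + g x y) a =
  c *: shuffle_sum p f a + shuffle_sum p g a.
Proof.
elim: a p f g => [|v a IH] p f g /=.
  by case: eqP => // _; rewrite scaler0 addr0.
rewrite IH; case: p => [|p]; last rewrite IH.
  by rewrite !add0r !scalerDr !scalerA mulrC.
by rewrite !scalerDr !scalerA [_ * c]mulrC !addrA; congr (_ + _); rewrite addrAC.
Qed.

Lemma shuffle_sum0 p f a : (forall x y, f x y = 0) -> shuffle_sum p f a = 0.
Proof.
elim: a p f => [|v a IH] p f f0 /=; first by rewrite f0 if_same.
rewrite [shuffle_sum p _ a]IH // scaler0 addr0; case: p => // p; exact: IH.
Qed.

Definition bimultilinear f :=
  (forall y, multilinear (f^~ y)) /\ (forall x, multilinear (f x)).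

Definition bialternating f :=
  (forall y, alternating (f^~ y)) /\ (forall x, alternating (f x)).

Lemma shuffle_sum_multilinear p f : bimultilinear f -> multilinear (shuffle_sum p f).
Proof.
move=> lf s1 c u v s2; elim: s1 p f lf => [|w s1 IH] p f [lf1 lf2] /=.
  rewrite scalerDr addrACA; congr (_ + _).
    case: p => [|p]; first by rewrite scaler0 addr0.
    rewrite -shuffle_sum_linear; apply: eq_shuffle_sum => x y.
    exact: (lf1 y [::]).
  rewrite scalerA mulrC -scalerA -scalerDr; congr (_ *: _).
  rewrite -shuffle_sum_linear; apply: eq_shuffle_sum => x y.
  exact: (lf2 x [::]).
rewrite scalerDr addrACA; congr (_ + _).
  case: p => [|p]; first by rewrite scaler0 addr0.
  by apply: IH; split=> [y|x]; [move=> t1; apply: (lf1 y (w :: t1)) | apply: lf2].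
rewrite scalerA mulrC -scalerA -scalerDr; congr (_ *: _).
by apply: IH; split=> [y|x]; [apply: lf1 | move=> t1; apply: (lf2 x (w :: t1))].
Qed.

Lemma shuffle_sum_alternating p f : bialternating f -> alternating (shuffle_sum p f).
Proof.
move=> af s1 u s2; elim: s1 p f af => [|w s1 IH] p f [af1 af2] /=; last first.
  rewrite [shuffle_sum p _ _]IH ?scaler0 ?addr0; last first.
    by split=> [y|x]; [apply: af1 | move=> t1; apply: (af2 x (w :: t1))].
  case: p => // p; apply: IH.
  by split=> [y|x]; [move=> t1; apply: (af1 y (w :: t1)) | apply: af2].
rewrite [shuffle_sum p (fun x y => f x (u :: u :: y)) s2]shuffle_sum0; last first.
  by move=> x y; apply: (af2 x [::]).
rewrite scaler0 addr0; case: p => [|p]; first by rewrite scaler0 addr0.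
rewrite exprS mulN1r scaleNr addrK.
case: p => // p; apply: shuffle_sum0 => x y; exact: (af1 y [::]).
Qed.

End ShuffleAlternating.

Definition meet0 (k : nat) (a b : seq V) : extalg :=
  if size b == k :> nat then
    shuffle_sum (D - k)%N (fun x y => (bracket0 (x ++ b) : K) *: extensor y) a
  else 0.

Lemma meet0E a b : ((size b <= D)%N && (D <= size a + size b)%N) ->
  meet_extensors a b = meet0 (size b) a b.
Proof.
case/andP=> leb lea; rewrite /meet0 eqxx -shuffle_sumE ?leq_subLR ?[(size b + _)%N]addnC //.
apply: eq_bigr => s _; rewrite scalerA /bracket0 size_cat size_takel ?subnK ?eqxx //.
by rewrite size_permute leq_subLR addnC.
Qed.

Lemma meet0_multilinearl k b : multilinear (fun a => meet0 k a b).
Proof.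
move=> s1 c u v s2; rewrite /meet0; case: eqP => _; last by rewrite scaler0 addr0.
apply: shuffle_sum_multilinear; split=> [y|x] t1 c' u' v' t2.
  by rewrite -!catA !cat_cons bracket0_multilinear scalerDl scalerA.
by rewrite extensor_multilinear scalerDr !scalerA mulrC.
Qed.

Lemma meet0_alternatingl k b : alternating (fun a => meet0 k a b).
Proof.
move=> s1 u s2; rewrite /meet0; case: eqP => _ //.
apply: shuffle_sum_alternating; split=> [y|x] t1 u' t2.
  by rewrite -!catA !cat_cons bracket0_alternating scale0r.
by rewrite extensor_alternating scaler0.
Qed.

Lemma meet0_multilinearr k a : multilinear (meet0 k a).
Proof.
apply: multilinear_size => s1 c u v s2 _; rewrite -shuffle_sum_linear.
apply: eq_shuffle_sum => x y.
by rewrite !catA bracket0_multilinear scalerDl scalerA.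
Qed.

Lemma meet0_alternatingr k a : alternating (meet0 k a).
Proof.
apply: alternating_size => s1 u s2 _; apply: shuffle_sum0 => x y.
by rewrite !catA bracket0_alternating scale0r.
Qed.

(* The meet of two extensors does not depend on how they are written.         *)
Lemma meet_extensorE a b : ((size b <= D)%N && (D <= size a + size b)%N) ->
  meet (extensor a) (extensor b) = meet_extensors a b.
Proof.
move=> leD; rewrite meet0E //.
rewrite (alternating_expand a (@meet0_multilinearl _ b) (@meet0_alternatingl _ b)).
apply: eq_bigr => S _ /=.
rewrite (alternating_expand b (@meet0_multilinearr _ _) (@meet0_alternatingr _ _)).
rewrite scaler_sumr; apply: eq_bigr => T _ /=; rewrite scalerA.
have [eS|/eqP neS] := #|S| =P size a; last by rewrite extensor_homogeneous // mul0r !scale0r.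
have [eT|/eqP neT] := #|T| =P size b; last by rewrite [extensor b T]extensor_homogeneous // mulr0 !scale0r.
by rewrite /meet_basis eS eT; case/andP: (leD) => leb ->; rewrite meet0E !size_evecs ?eS ?eT.
Qed.

End GrassmannCayley.

(* Main.v *)
Require Import Defs.
From mathcomp Require Import all_boot all_order all_algebra.
Import GRing.Theory.
Local Open Scope ring_scope.

(** Write [L] for the list of the [d - 2] points outside [I].  Each of the three
    meets cuts a subspace [x y s], where [s] is a sublist of [L], with a
    hyperplane [b] spanned by [L] and two further points.  In the expansion of
    the meet, the terms that put an element of [s] in the bracket vanish, since
    that element is already in [b].  The two remaining terms combine into
    [w s] with the vector [w = [x b] y - [y b] x], which does not depend on [s];
    when it is not zero, it represents the point where the line [x y] meets the
    hyperplane [b] ([meet_extensor_hyperplane]).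

    Hence both expressions are extensors: the first one is [w1 w2 w3 L], and the
    second one is [w1 J1 w2 J2 w3 J3 J4], with the same three vectors [wi].
    Because [J1], [J2], [J3], [J4] partition the complement of [I], the second
    list of vectors is a rearrangement of the first one, so the two extensors
    agree up to sign ([alternating_perm]) and vanish together. *)

Section Alternating.
Local Set Implicit Arguments.
Variables (K : fieldType) (D : nat) (W : lmodType K) (F : seq 'rV[K]_D -> W).
Hypotheses (linF : multilinear F) (altF : alternating F).

Lemma alternating_mem u s : u \in s -> F (u :: s) = 0.
Proof.
case/splitPr=> s1 s2.
by rewrite (alternating_move linF altF [::]) /= altF scaler0.
Qed.

(** Prepending a prefix [s0] makes the statement strong enough for induction on
    [s]: the head of [s] is moved to its place in [t], which costs a sign, and
    then joins the prefix. *)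
Lemma alternating_perm_prefix s0 s t :
  perm_eq s t -> exists n : nat, F (s0 ++ s) = (-1) ^+ n *: F (s0 ++ t).
Proof.
elim: s s0 t => [|u s IH] s0 t.
  by rewrite perm_sym => /perm_nilP->; exists 0%N; rewrite expr0 scale1r.
move=> eq_ust; have ut : u \in t by rewrite -(perm_mem eq_ust) mem_head.
case/splitPr: ut eq_ust => t1 t2 eq_ust.
have eq_st : perm_eq s (t1 ++ t2).
  by rewrite -(perm_cons u) (perm_trans eq_ust) // -[u :: t2]cat1s perm_catCA.
have [n Fs] := IH (rcons s0 u) _ eq_st.
exists (n + size t1)%N; rewrite -cat_rcons Fs cat_rcons.
by rewrite alternating_move // scalerA exprD.
Qed.

Lemma alternating_perm s t :
  perm_eq s t -> exists n : nat, F s = (-1) ^+ n *: F t.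
Proof. exact: (alternating_perm_prefix [::]). Qed.

End Alternating.

Lemma extensor_perm_eq0 (K : fieldType) (D : nat) (s t : seq 'rV[K]_D) :
  perm_eq s t -> extensor s = 0 <-> extensor t = 0.
Proof.
case/(alternating_perm (@extensor_multilinear K D) (@extensor_alternating K D)).
move=> n ->; split=> [/eqP|->]; last by rewrite scaler0.
by rewrite scaler_eq0 signr_eq0 => /eqP.
Qed.

Section MeetHyperplane.
Variables (K : fieldType) (D : nat).
Implicit Types (x y : 'rV[K]_D) (s b : seq 'rV[K]_D).

Lemma shuffle_sum_p0 (W : lmodType K) (f : seq 'rV[K]_D -> seq 'rV[K]_D -> W) s :
  shuffle_sum 0 f s = f [::] s.
Proof. by elim: s f => [|u s IH] f //=; rewrite add0r scale1r IH. Qed.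

Lemma shuffle_sum_p1_eq0 (W : lmodType K)
    (f : seq 'rV[K]_D -> seq 'rV[K]_D -> W) s :
  (forall u t, u \in s -> f [:: u] t = 0) -> shuffle_sum 1 f s = 0.
Proof.
elim: s f => [|u s IH] f f0 //=.
rewrite shuffle_sum_p0 f0 ?mem_head // IH ?scaler0 ?addr0 // => w t ws.
by rewrite f0 // inE ws orbT.
Qed.

(** When [x], [y] span a line and [b] spans a hyperplane not containing it, this
    vector represents their intersection point: it lies on the line, and
    its bracket with [b] is zero. *)
Definition line_hyperplane (b : seq 'rV[K]_D) x y : 'rV[K]_D :=
  bracket (x :: b) *: y - bracket (y :: b) *: x.

(** Only the terms with [x] or [y] in the bracket survive: a bracket containing
    an element of [s] has a repeated vector. *)
Lemma meet_extensor_hyperplane x y s b :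
  (size b).+1 = D -> {subset s <= b} ->
  meet (extensor [:: x, y & s]) (extensor b)
  = extensor (line_hyperplane b x y :: s).
Proof.
move=> szb sb.
have leb : (size b <= D)%N by rewrite (leq_trans (leqnSn _)) ?szb.
have leD : (D <= size [:: x, y & s] + size b)%N.
  by rewrite (leq_trans (eq_leq (esym szb))) //= !addSn ltnS -addSn leq_addl.
rewrite meet_extensorE ?leb // meet0E ?leb // /meet0 eqxx.
have := subSnn (size b); rewrite szb => ->.
rewrite /= !shuffle_sum_p0 shuffle_sum_p1_eq0 => [|u t us]; last first.
  rewrite alternating_mem ?scale0r ?sb //.
    exact: bracket0_multilinear.
  exact: bracket0_alternating.
rewrite scaler0 addr0 /bracket0 /= szb eqxx expr1 scaleN1r.
have ext_vecZ c u : ext_vec (c *: u : 'rV[K]_D) = c *: ext_vec u.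
  by rewrite /ext_vec scaler_sumr; apply: eq_bigr => i _; rewrite mxE scalerA.
rewrite /line_hyperplane -!scaleNr !extensor_cons ext_vec_linear ext_vecZ.
by rewrite join_linl joinZl add0r scale1r.
Qed.

End MeetHyperplane.

Lemma perm_enum_setU (T : finType) (A B : {set T}) :
  [disjoint A & B] -> perm_eq (enum (A :|: B)) (enum A ++ enum B).
Proof.
move=> dAB; apply: uniq_perm; rewrite ?enum_uniq //.
  rewrite cat_uniq !enum_uniq andbT /=; apply/hasPn=> k.
  by rewrite !mem_enum => kB; rewrite (disjointFl dAB kB).
by move=> k; rewrite mem_cat !mem_enum inE.
Qed.

Theorem theorem5p4 (K : closedFieldType) (d : nat) (hd : (3 <= d)%N)
    (P : 'I_(d + 4) -> proj_point K d.+1)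
    (I : {set 'I_(d + 4)}) (i1 i2 i3 i4 i5 i6 : 'I_(d + 4))
    (hi : [&& i1 < i2, i2 < i3, i3 < i4, i4 < i5 & i5 < i6]%N)
    (hI : I = [set i1; i2; i3; i4; i5; i6])
    (J1 J2 J3 J4 : {set 'I_(d + 4)})
    (hJ : J1 :|: J2 :|: J3 :|: J4 = ~: I)
    (hJ12 : [disjoint J1 & J2]) (hJ13 : [disjoint J1 & J3])
    (hJ14 : [disjoint J1 & J4]) (hJ23 : [disjoint J2 & J3])
    (hJ24 : [disjoint J2 & J4]) (hJ34 : [disjoint J3 & J4])
    (v : 'I_(d + 4) -> 'rV[K]_d.+1) (hv : forall k, represents (v k) (P k)) :
  join (join (join
    (meet (extensor [:: v i1; v i2])
          (extensor [:: v i4, v i5 & points v (~: I)]))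
    (meet (extensor [:: v i2; v i3])
          (extensor [:: v i5, v i6 & points v (~: I)])))
    (meet (extensor [:: v i3; v i4])
          (extensor [:: v i6, v i1 & points v (~: I)])))
    (extensor (points v (~: I))) = 0
  <->
  join (join (join
    (meet (extensor [:: v i1, v i2 & points v J1])
          (extensor [:: v i4, v i5 & points v (~: I)]))
    (meet (extensor [:: v i2, v i3 & points v J2])
          (extensor [:: v i5, v i6 & points v (~: I)])))
    (meet (extensor [:: v i3, v i4 & points v J3])
          (extensor [:: v i6, v i1 & points v (~: I)])))
    (extensor (points v J4)) = 0.
Proof.
set L := points v (~: I).
have cardI : #|I| = 6.
  pose s := [:: i1; i2; i3; i4; i5; i6].
  have us : uniq s.
    rewrite -(map_inj_uniq val_inj) (sorted_uniq ltn_trans ltnn) //=.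
    by rewrite andbT.
  rewrite hI -[6]/(size s) -(card_uniqP us).
  by apply: eq_card => k; rewrite !inE -!orbA.
have szL : (size L).+3 = d.+1.
  have := cardsC I; rewrite cardI card_ord size_map -cardE.
  by move: #|~: I| => m; rewrite !addSn !addnS addn0 add0n => -[->].
have permL : perm_eq (points v J1 ++ points v J2 ++ points v J3 ++ points v J4) L.
  rewrite -!map_cat perm_map // perm_sym -hJ !catA.
  rewrite (perm_trans (perm_enum_setU _ _ _ _)) ?setU_disjoint ?hJ14 ?hJ24 //.
  rewrite perm_cat2r (perm_trans (perm_enum_setU _ _ _ _)) ?setU_disjoint ?hJ13 //.
  by rewrite perm_cat2r perm_enum_setU.
have subL x y (J : {set 'I_(d + 4)}) : J \subset ~: I ->
    {subset points v J <= [:: x, y & L]}.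
  move=> /subsetP sJ _ /mapP[k kJ ->]; rewrite !inE map_f ?orbT // mem_enum sJ //.
  by rewrite -mem_enum.
have [J1I J2I J3I] : [/\ J1 \subset ~: I, J2 \subset ~: I & J3 \subset ~: I].
  by rewrite -hJ; split; apply/subsetP=> k kJ; rewrite !inE kJ ?orbT.
rewrite !meet_extensor_hyperplane /= ?szL //; try exact: subL.
rewrite -!extensor_cat -!catA; apply: extensor_perm_eq0 => /=.
(* Each vector of a meet moves to the front past the blocks before it. *)
rewrite perm_sym perm_cons -cat1s perm_catCA cat1s perm_cons.
by rewrite catA -cat1s perm_catCA cat1s perm_cons -catA.
Qed.
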